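(* Let $k\ge 1$ and let $K$ be the negative $(2,2k+1)$-torus knot (the closure of the 2-strand braid $\sigma_1^{-(2k+1)}$). Then the tail of the colored Jones polynomial of $K$ exists and equals $$T_K(q)=f(-q^{2k},-q).$$
   Context: $J_{N,K}(q)$ denotes the colored Jones polynomial of a link $K$ associated to the $N$-dimensional irreducible representation of $U_q(\mathfrak{sl}_2)$ (all components colored by $N$), normalized so that $J_{N,\text{unknot}}=1$; $J_{2,K}$ is the Jones polynomial. For a Laurent polynomial $P$ (possibly in $q^{1/2}$) and a power series $S$, write $P\doteq_n S$ if there exist a sign $\varepsilon$ and an exponent $s$ such that $\varepsilon q^{s}P(q)$ is a power series in $q$ that is congruent to $S(q)$ modulo $q^n$. The tail of $K$ is a power series $T_K(q)=\sum_{j\ge0}a_jq^j$ with $J_{N,K}(q)\doteq_N T_K(q)$ for every $N\ge1$. Ramanujan's general theta function is $f(a,b)=\sum_{k=-\infty}^{\infty}a^{k(k+1)/2}b^{k(k-1)/2}$. *)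

(* Defs.v *)
From HB Require Import structures.
From mathcomp Require Import all_boot all_order all_algebra.
From mathcomp Require Import fraction.
Set Implicit Arguments. Unset Strict Implicit. Unset Printing Implicit Defensive.
Import Order.TTheory GRing.Theory Num.Theory.
Local Open Scope ring_scope.

(* Ground field: F = Q(x), where the indeterminate x stands for q^(1/4).      *)
Definition F : fieldType := {fraction {poly rat}}.
Definition frac_of (p : {poly rat}) : F := @FracField.tofrac _ p.
Definition qx : F := frac_of 'X.
Definition qv : F := qx ^+ 2.
Definition qq : F := qx ^+ 4.

Definition qint (n : nat) : F := (qv ^+ n - qv ^- n) / (qv - qv^-1).
Definition qfact (n : nat) : F := \prod_(i < n) qint i.+1.

(* weight of the basis vector e_i of the N-dimensional irreducible
   U_q(sl2)-module V_N (basis e_0,...,e_{N-1}, H e_i = (N-1-2i) e_i,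
   E e_i = [N-i] e_{i-1}, F e_i = [i+1] e_{i+1}). *)
Definition wt (N i : nat) : int := (N%:Z - 1 - 2 * i%:Z)%R.

(* Coefficient of e_a (x) e_b in c(e_i (x) e_j), where c = tau o R is the
   braiding on V_N (x) V_N given by the universal R-matrix
     R = q^(H(x)H/4) sum_n q^(n(n-1)/4) (q^(1/2)-q^(-1/2))^n/[n]! E^n (x) F^n. *)
Definition braid_coef (N i j a b : nat) : F :=
  if (i + j == a + b)%N && (j <= a)%N && (a < N)%N && (b < N)%N then
    let n := (a - j)%N in
    qx ^ (wt N b * wt N a) * qx ^+ (n * n.-1) * (qv - qv^-1) ^+ n / qfact n
    * (\prod_(t < n) qint (N - i + t)) * (\prod_(t < n) qint (j + t.+1))
  else 0.

(* V_N (x) V_N is identified with F^(N*N) via e_i (x) e_j  <->  i*N + j.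
   Matrices act on row vectors (mathcomp convention). *)
Definition braid_mx (N : nat) : 'M[F]_(N * N) :=
  \matrix_(r < N * N, s < N * N)
     braid_coef N (r %/ N) (r %% N) (s %/ N) (s %% N).

(* The representation of the 2-strand braid sigma_1^m (m : int).  The
   crossing sigma_1^(-1) acts by the braiding c (this orientation convention
   is the one for which J_2 is the Jones polynomial with
   V(left-handed trefoil) = q^-1 + q^-3 - q^-4). *)
Definition braid_rep (N : nat) (m : int) : 'M[F]_(N * N) :=
  match m with
  | Posz n => iter n (mulmx (invmx (braid_mx N))) 1%:M
  | Negz n => iter n.+1 (mulmx (braid_mx N)) 1%:M
  end.

(* quantum trace with pivotal element K (x) K, K = q^(H/2) *)
Definition qtrace (N : nat) (M : 'M[F]_(N * N)) : F :=
  \sum_(r < N * N) qx ^ (2 * (wt N (r %/ N) + wt N (r %% N))) * M r r.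

(* Colored Jones polynomial J_{N,L}(q) of the closure L of the 2-strand braid
   sigma_1^m, all components colored by V_N, normalized by J(unknot)=1;
   the factor q^((N^2-1)m/4) is the framing (twist) correction for writhe m. *)
Definition cjones_2braid (N : nat) (m : int) : F :=
  qx ^ (((N ^ 2)%:Z - 1) * m) * qtrace (braid_rep N m) / qint N.

(* P ≐_n S : there are a sign eps and an exponent s with eps q^s P a power
   series in q (here necessarily a polynomial, P being a Laurent polynomial)
   congruent to S modulo q^n.  The exponent s ranges over (1/4)Z
   (q^(s/4) = x^s), which is harmless since P is a Laurent polynomial in q^(1/2). *)
Definition approx_eq (P : F) (n : nat) (S : nat -> int) : Prop :=
  exists (eps : bool) (s : int) (p : {poly rat}),
    (-1) ^+ eps * qx ^ s * P = (map_poly (fun c : rat => frac_of c%:P) p).[qq]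
    /\ forall j : nat, (j < n)%N -> p`_j = (S j)%:~R.

(* Coefficients of Ramanujan's theta function f(a,b) = sum_{m in Z}
   a^(m(m+1)/2) b^(m(m-1)/2) for monomials a = c1 q^e1, b = c2 q^e2 with
   e1, e2 >= 1: the q^j-coefficient.  The term for m >= 0 has exponent
   >= m and the term for m = -(n+1) has exponent >= n+1, so only |m| <= j
   contributes; the sum below runs over exactly those m. *)
Definition theta_term (c1 c2 : int) (e1 e2 A B j : nat) : int :=
  if (e1 * A + e2 * B == j)%N then c1 ^+ A * c2 ^+ B else 0.

Definition theta_coef (c1 c2 : int) (e1 e2 : nat) (j : nat) : int :=
  \sum_(n < j.+1)   (* m = n >= 0 : A = n(n+1)/2, B = n(n-1)/2 *)
     theta_term c1 c2 e1 e2 (n * n.+1)./2 (n * n.-1)./2 j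
  + \sum_(n < j.+1) (* m = -(n+1) : A = n(n+1)/2, B = (n+1)(n+2)/2 *)
     theta_term c1 c2 e1 e2 (n * n.+1)./2 (n.+1 * n.+2)./2 j.

(* Main.v *)
(* The braiding c on V_N (x) V_N commutes with the lowering operator F, which
   embeds the weight space i + j = s into the weight space i + j = s + 1 with a
   one-dimensional quotient spanned by e_0 (x) e_(s+1). On that quotient c acts
   by an explicit signed monomial, because c maps e_0 (x) e_(s+1) to a multiple
   of e_(s+1) (x) e_0. This gives the traces of all powers of c on the weight
   spaces s < N, and the symmetry (i, j) -> (N-1-j, N-1-i) gives the others.
   Summation by parts turns the quantum trace into
     J = +- q^(...) G(q) / (1 - q^N),
     G = sum_(0 <= d < N) (-1)^d (q^(E d) - q^(E' d)),
   where E d and E' d are the exponents of the theta series f(-q^(2k), -q).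

   It remains to see that 1 - q^N divides G. At a root of unity w of order
   d | N, G(w) is the sum of (-1)^i w^(E i) over i mod 2N. With m = 2k + 1: if
   m and d are not coprime, a shift of i multiplies every term by the same
   nontrivial root of unity; if m e = 1 mod d, the reflection i -> 2e - 1 - i
   changes the sign of every term. In both cases G(w) = 0. *)
Require Import Defs.
From HB Require Import structures.
From mathcomp Require Import all_boot all_order all_algebra.
From mathcomp Require Import all_field fraction.
From mathcomp Require Import ring zify.
Set Implicit Arguments. Unset Strict Implicit. Unset Printing Implicit Defensive.
Import Order.TTheory GRing.Theory Num.Theory.
Local Open Scope ring_scope.

(* The scalar identity to which the intertwining relation reduces, with
   [v ^+ p = P], [v ^+ b = B], [v ^+ r = R] and [N = b + p + 1 + r]. *)
Lemma intertwine_scalar (K : fieldType) (v P B R : K) :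
  v != 0 -> P != 0 -> B != 0 -> R != 0 ->
  v - v^-1 != 0 -> v * P - (v * P)^-1 != 0 ->
  let D := v - v^-1 in
  let br z := (z - z^-1) / D in
  br (v * (B * P)) * br R * D * P / br (v * P)
    + (v * (B * P * R) / (v * (B * P) ^+ 2))^-1
  = v * (B * P * R) / (v * B ^+ 2) + br (v * (P * R)) * br B * D * P / br (v * P).
Proof.
move=> v0 P0 B0 R0 D0 E0 /=; field.
rewrite v0 P0 B0 R0 /=.
have -> : v * v + - 1 = (v - v^-1) * v by field.
have -> : v * P * (v * P) + - 1 = (v * P - (v * P)^-1) * (v * P) by field; rewrite P0 v0.
by rewrite !mulf_neq0.
Qed.

Lemma wt_succ N a : wt N a = wt N a.+1 + 2.
Proof. by rewrite /wt; lia. Qed.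

(** * The R-matrix over a general field and its commutation with the lowering operator *)

Section GenericBraiding.
Variables (K : fieldType) (x : K).

Let v := x ^+ 2.

(* The constructions of [Defs], with an arbitrary [x] in place of q^(1/4). *)
Definition qnum (n : nat) : K := (v ^+ n - v ^- n) / (v - v^-1).

Definition braidc (N i j a b : nat) : K :=
  if (i + j == a + b)%N && (j <= a)%N && (a < N)%N && (b < N)%N then
    let n := (a - j)%N in
    x ^ (wt N b * wt N a) * x ^+ (n * n.-1) * (v - v^-1) ^+ n
      / (\prod_(i < n) qnum i.+1)
    * (\prod_(t < n) qnum (N - i + t)) * (\prod_(t < n) qnum (j + t.+1))
  else 0.

Lemma braidcE N j b n : (j + n < N)%N -> (b < N)%N ->
  braidc N (b + n) j (j + n) b
  = x ^ (wt N b * wt N (j + n)) * x ^+ (n * n.-1) * (v - v^-1) ^+ n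
      / (\prod_(i < n) qnum i.+1)
    * (\prod_(t < n) qnum (N - (b + n) + t)) * (\prod_(t < n) qnum (j + t.+1)).
Proof.
move=> jn_lt b_lt; rewrite /braidc jn_lt b_lt leq_addr addKn.
by have -> : (b + n + j == j + n + b)%N by apply/eqP; lia.
Qed.

Lemma braidc_eq0 N i j a b : (a < j)%N -> braidc N i j a b = 0.
Proof. by move=> a_lt; rewrite /braidc leqNgt a_lt andbF. Qed.

Hypotheses (x_neq0 : x != 0) (x_nonroot : forall n, (0 < n)%N -> x ^+ n != 1).

Let v_neq0 : v != 0. Proof. exact: expf_neq0. Qed.

Lemma expn_subV_neq0 n : (0 < n)%N -> v ^+ n - v ^- n != 0.
Proof.
move=> n_gt0; rewrite subr_eq0 -(inj_eq (mulIf (expf_neq0 n v_neq0))).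
rewrite mulVf ?expf_neq0 // -exprD -exprM.
by apply: x_nonroot; rewrite muln_gt0 addn_gt0 n_gt0.
Qed.

Lemma subV_neq0 : v - v^-1 != 0. Proof. exact: (@expn_subV_neq0 1). Qed.

Lemma qnum_neq0 n : (0 < n)%N -> qnum n != 0.
Proof.
by move=> n_gt0; rewrite mulf_neq0 ?expn_subV_neq0 // invr_neq0 // subV_neq0.
Qed.

Lemma qnum0 : qnum 0 = 0.
Proof. by rewrite /qnum expr0 invr1 subrr mul0r. Qed.

Lemma exprz_sqr (z : int) : v ^ z = x ^ (2 * z).
Proof. by rewrite -exprz_exp. Qed.

Lemma exprz_wt N b : v ^ wt N b = v ^+ N / (v * (v ^+ b) ^+ 2).
Proof.
by rewrite /wt -addrA -opprD !expfzDr // -invr_expz expfzDr // expr1z -exprM mulnC.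
Qed.

(** Entry form of the relation between c and F (x) 1 + K^-1 (x) F, read off from e_i (x) e_j to e_a
    (x) e_b. The bound on i + j keeps every index below N, away from the truncation F e_(N-1) =
    0. *)
Lemma braidc_intertwine N i j a b : (i + j).+1 = (a + b)%N -> (i + j < N.-1)%N ->
  qnum i.+1 * braidc N i.+1 j a b + qnum j.+1 / v ^ wt N i * braidc N i j.+1 a b
  = (if a is a'.+1 then braidc N i j a' b * qnum a else 0)
    + (if b is b'.+1 then braidc N i j a b' * (qnum b / v ^ wt N a) else 0).
Proof.
move=> ij_ab ij_lt; case: (ltngtP a j) => [a_lt | j_lt | a_eq].
- rewrite (@braidc_eq0 N i.+1) ?(@braidc_eq0 N i j.+1) ?leqW // !mulr0 addr0.
  rewrite (_ : (if b is b'.+1 then _ else 0) = 0); last first.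
    by case: b {ij_ab} => // b; rewrite braidc_eq0 ?mul0r.
  by case: a a_lt {ij_ab} => [|a] a_lt; rewrite ?addr0 // braidc_eq0 ?mul0r ?addr0 // ltnW.
(* In terms of p = a - j - 1 and r = N - 1 - i the four coefficients differ only by a few explicit
   factors. *)
- have [p a_def] : exists p, a = (j + p.+1)%N by exists (a - j).-1; lia.
  have i_def : i = (b + p)%N by lia.
  subst a i; clear j_lt.
  have [r N_def] : exists r, N = (b + p + r).+1 by exists (N.-1 - (b + p))%N; lia.
  have r_gt0 : (0 < r)%N by lia.
  have -> : (if (j + p.+1)%N is a'.+1 then braidc N (b + p) j a' b * qnum (j + p.+1) else 0)
            = braidc N (b + p) j (j + p) b * qnum (j + p.+1) by rewrite addnS.
  set X := x ^ (wt N b * wt N (j + p.+1)).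
  set Pi := \prod_(t < p) qnum (N - (b + p) + t).
  set Psi := \prod_(t < p) qnum (j.+1 + t.+1).
  set fact_p := \prod_(t < p) qnum t.+1.
  have fact_p0 : fact_p != 0 by apply/prodf_neq0 => t _; apply: qnum_neq0.
  have Pi_last : \prod_(t < p.+1) qnum (N - (b + p) + t) = Pi * qnum (p + r).+1.
    by rewrite big_ord_recr /=; congr (_ * qnum _); clear -N_def; lia.
  have Pi_first : \prod_(t < p.+1) qnum (N - (b + p.+1) + t) = qnum r * Pi.
    rewrite big_ord_recl; congr (qnum _ * _); first by rewrite /=; clear -N_def; lia.
    by apply: eq_bigr => t _; rewrite lift0; congr qnum; clear -N_def; lia.
  have Psi_first : \prod_(t < p.+1) qnum (j + t.+1) = qnum j.+1 * Psi.
    rewrite big_ord_recl addn1; congr (_ * _).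
    by apply: eq_bigr => t _; rewrite lift0 addSnnS.
  have Psi_last : \prod_(t < p) qnum (j + t.+1) * qnum (j + p.+1) = qnum j.+1 * Psi.
    by rewrite -Psi_first big_ord_recr.
  (* For b = 0 the closed form vanishes because [0] = 0, so one formula covers both cases. *)
  have -> : (if b is b'.+1 then braidc N (b + p) j (j + p.+1) b'
      * (qnum b / v ^ wt N (j + p.+1)) else 0)
     = X * x ^+ (p.+1 * p) * (v - v^-1) ^+ p.+1 / (fact_p * qnum p.+1)
       * (Pi * qnum (p + r).+1) * (qnum j.+1 * Psi) * qnum b.
    rewrite /X; case: (b) Pi_last N_def => [|b'] Pi_last N_def; first by rewrite qnum0 mulr0.
    rewrite addSnnS braidcE; [|lia|lia].
    rewrite addSnnS in Pi_last; rewrite Pi_last Psi_first big_ord_recr /=.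
    rewrite (wt_succ N b') mulrDl expfzDr // -exprz_sqr.
    set y := v ^ _; have y0 : y != 0 by rewrite expfz_neq0.
    by rewrite -/fact_p; set D := v - _; field; rewrite y0 fact_p0 qnum_neq0.
  rewrite -[(b + p).+1]addnS braidcE; [|lia|lia].
  rewrite -[in X in _ + X = _](addSnnS j p) braidcE; [|lia|lia].
  rewrite braidcE; [|lia|lia].
  rewrite -[_ * _ * qnum (j + p.+1)]mulrA Psi_last Pi_first Psi_first addSnnS -/X -/Pi -/Psi.
  rewrite [in \prod_(_ < p.+1) _]big_ord_recr /= -/fact_p.
  have -> : x ^ (wt N b * wt N (j + p)) = X * v ^ wt N b.
    by rewrite (wt_succ N (j + p)) -addnS mulrDr expfzDr // exprz_sqr (mulrC 2).
  have -> : x ^+ (p.+1 * p) = x ^+ (p * p.-1) * v ^+ p.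
    by rewrite -exprM -exprD; congr (_ ^+ _); case: (p) => // p'; lia.
  have scalar_eq : qnum (b + p).+1 * qnum r * (v - v^-1) * v ^+ p / qnum p.+1
      + (v ^ wt N (b + p))^-1
    = v ^ wt N b + qnum (p + r).+1 * qnum b * (v - v^-1) * v ^+ p / qnum p.+1.
    rewrite !exprz_wt {1 2}N_def /qnum !(exprS v) !exprD.
    by apply: intertwine_scalar; rewrite ?expf_neq0 ?subV_neq0 -?exprS ?expn_subV_neq0.
  move: scalar_eq; set D := v - _; rewrite (exprS D) => scalar_eq.
  (* [C] is the factor common to the four terms; what remains is [scalar_eq]. *)
  pose C := X * x ^+ (p * p.-1) * D ^+ p / fact_p * Pi * Psi * qnum j.+1.
  transitivity (C * (qnum (b + p).+1 * qnum r * D * v ^+ p / qnum p.+1 + (v ^ wt N (b + p))^-1)).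
    by rewrite /C addnS; field; rewrite fact_p0 qnum_neq0 // expfz_neq0.
  by rewrite scalar_eq /C; field; rewrite fact_p0 qnum_neq0.
- subst a.
  have -> : b = i.+1 by lia.
  rewrite (@braidc_eq0 N _ j.+1) ?mulr0 ?addr0 //.
  have -> : (if j is a'.+1 then braidc N i j a' i.+1 * qnum j else 0) = 0.
    by case: j {ij_ab ij_lt} => // j; rewrite braidc_eq0 ?mul0r.
  rewrite add0r.
  have := @braidcE N j i.+1 0; rewrite !addn0 => ->; [|lia|lia].
  have := @braidcE N j i 0; rewrite !addn0 => ->; [|lia|lia].
  rewrite !big_ord0 !mulr1 (wt_succ N i) [(_ + 2) * _]mulrDl expfzDr // -exprz_sqr.
  set y := v ^ _; have y0 : y != 0 by rewrite expfz_neq0.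
  by field; rewrite y0 oner_neq0.
Qed.
End GenericBraiding.

(** In the basis made of e and the rows of G, C is block triangular: it acts as A on the invariant
    row space of G and as mu on the one-dimensional quotient. *)
Lemma mxtrace_exp_triangular (K : fieldType) n (A : 'M[K]_n) (C : 'M[K]_n.+1)
    (G : 'M[K]_(n, n.+1)) (e : 'rV[K]_n.+1) (mu : K) (y : 'rV[K]_n) m :
  (col_mx e G : 'M_n.+1) \in unitmx -> G *m C = A *m G ->
  e *m C = mu *: e + y *m G ->
  \tr (C ^+ m) = mu ^+ m + \tr (A ^+ m).
Proof.
move=> B_unit GC eC; set B : 'M_n.+1 := col_mx e G in B_unit.
pose T : 'M[K]_(1 + n) := block_mx mu%:M y 0 A.
have BC : B *m C = T *m B.
  change (col_mx e G *m C = T *m col_mx e G).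
  by rewrite mul_col_mx /T mul_block_col eC GC mul_scalar_mx mul0mx add0r.
have [y' T_exp] : exists y' : 'rV[K]_n, T ^+ m = block_mx (mu ^+ m)%:M y' 0 (A ^+ m).
  elim: m => [|m [y' IH]]; first by exists 0; rewrite !expr0 -scalar_mx_block.
  exists (mu%:M *m y' + y *m A ^+ m).
  rewrite exprS IH [LHS](mulmx_block mu%:M y 0 A) !mulmx0 !mul0mx !addr0 !add0r.
  by rewrite -scalar_mxM -exprS -[A *m _]/(A * _) -exprS.
have BCm : B *m C ^+ m = T ^+ m *m col_mx e G.
  elim: (m) => [|k IH]; first by rewrite !expr0 mulmx1 mul1mx.
  by rewrite exprSr mulmxA IH -mulmxA BC mulmxA -[_ *m T]/(_ * _) -exprSr.
have -> : C ^+ m = invmx B *m (T ^+ m *m col_mx e G) by rewrite -BCm mulKmx.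
rewrite mxtrace_mulC mulmxK // T_exp.
by rewrite (mxtrace_block (mu ^+ m)%:M y' 0) mxtrace_scalar.
Qed.

Lemma sum_delta (R : pzRingType) n k (f : nat -> R) :
  \sum_(u < n) (u == k :> nat)%:R * f u = if (k < n)%N then f k else 0.
Proof.
case: ltnP => [k_lt | k_ge].
  rewrite (bigD1 (Ordinal k_lt)) //= eqxx mul1r big1 ?addr0 // => u.
  by rewrite -val_eqE /= => /negPf ->; rewrite mul0r.
by rewrite big1 // => u _; rewrite ltn_eqF ?mul0r // (leq_trans (ltn_ord u)).
Qed.

(** * Traces of powers of the braiding on the weight spaces s < N *)

Section WeightSpaces.
Variables (K : fieldType) (x : K).
Hypotheses (x_neq0 : x != 0) (x_nonroot : forall n, (0 < n)%N -> x ^+ n != 1).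
Variable N : nat.

Let v := x ^+ 2.
Let v_neq0 : v != 0. Proof. exact: expf_neq0. Qed.

Definition weight_braid s : 'M[K]_s.+1 :=
  \matrix_(i < s.+1, a < s.+1) braidc x N i (s - i) a (s - a).

(* The operator [F (x) 1 + K^-1 (x) F] from weight space [s] to weight space
   [s + 1]. *)
Definition weight_lower s : 'M[K]_(s.+1, s.+2) :=
  \matrix_(i < s.+1, u < s.+2)
    ((u == i.+1 :> nat)%:R * qnum x i.+1
     + (u == i :> nat)%:R * (qnum x (s - i).+1 / v ^ wt N i)).

Lemma weight_lowerC s : (s.+1 < N)%N ->
  weight_lower s *m weight_braid s.+1 = weight_braid s *m weight_lower s.
Proof.
move=> s_lt; apply/matrixP => i a; rewrite !mxE.
have i_lt := ltn_ord i; have i_le : (i <= s)%N by rewrite -ltnS. have a_lt := ltn_ord a.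
under eq_bigr => u _ do rewrite !mxE mulrDl -(mulrA _ (qnum x _)) -(mulrA _ (_ / _)).
rewrite big_split /=.
rewrite [X in X + _ = _](sum_delta _ i.+1
  (fun u => qnum x i.+1 * braidc x N u (s.+1 - u) a (s.+1 - a))).
rewrite [X in _ + X = _](sum_delta _ i (fun u => _ / _ * braidc x N u (s.+1 - u) a (s.+1 - a))).
rewrite ltnS i_lt ltnW // subSS (subSn i_le) /v.
rewrite braidc_intertwine //; [|lia|lia].
under eq_bigr => u _ do rewrite !mxE mulrDr mulrCA [X in _ + X]mulrCA.
rewrite big_split /=; congr (_ + _).
  case: (nat_of_ord a) a_lt => [|a'] a_lt; first by rewrite big1 // => u _; rewrite mul0r.
  rewrite ltnS in a_lt; under eq_bigr => u _ do rewrite eqSS eq_sym.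
  rewrite [RHS](sum_delta _ a' (fun u => braidc x N i (s - i) u (s - u) * qnum x u.+1)) a_lt.
  by rewrite subSS.
under eq_bigr => u _ do rewrite eq_sym.
rewrite [RHS](sum_delta _ a
  (fun u => braidc x N i (s - i) u (s - u) * (qnum x (s - u).+1 / v ^ wt N u))).
case: ltnP => a_s; last by have -> : (s.+1 - a = 0)%N by lia.
by rewrite subSn.
Qed.

(** The scalar of c on the quotient line of weight space i. The first exponent comes from mapping
    e_0 (x) e_i to e_i (x) e_0, the sign and the second exponent from returning to e_0 (x) e_i
    modulo the image of the lowering operator. *)
Definition eigenval i : K := (-1) ^+ i * x ^ (wt N 0 * wt N i + 2 * (i%:Z * (i%:Z - N%:Z))).

Lemma prod_invz_wt n : \prod_(r < n) (v ^ wt N r)^-1 = x ^ (2 * (n%:Z * (n%:Z - N%:Z))).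
Proof.
elim: n => [|n IH]; first by rewrite big_ord0 mul0r mulr0.
rewrite big_ord_recr /= IH exprz_sqr // invr_expz -expfzDr //.
by congr (x ^ _); rewrite /wt; rewrite intS; ring.
Qed.

(** Lowering e_t (x) e_(s-t) gives a relation between e_(t+1) (x) e_(s-t) and e_t (x) e_(s+1-t)
    modulo the image; iterating it multiplies the ratios. *)
Lemma lower_quotient s t : (t < s.+2)%N -> exists y : 'rV[K]_s.+1,
  delta_mx 0 (inord t)
  = (\prod_(r < t) - (qnum x (s - r).+1 / v ^ wt N r / qnum x r.+1)) *: delta_mx 0 0
    + y *m weight_lower s.
Proof.
elim: t => [|t IH] t_lt.
  exists 0; rewrite big_ord0 scale1r mul0mx addr0; congr delta_mx.
  by apply/val_inj; rewrite /= inordK.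
have [y y_eq] := IH (ltnW t_lt).
pose row_t : 'rV[K]_s.+1 := delta_mx 0 (inord t).
set q := qnum x (s - t).+1 / v ^ wt N t.
have q0 := qnum_neq0 x_neq0 x_nonroot (ltn0Sn t).
have row_eq : row_t *m weight_lower s
    = qnum x t.+1 *: delta_mx 0 (inord t.+1) + q *: delta_mx 0 (inord t).
  rewrite -rowE; apply/rowP => u; rewrite !mxE !inordK // ?ltnW // -!val_eqE /=.
  by rewrite !inordK // ?(ltnW t_lt) // mulrC [X in _ + X]mulrC.
exists ((qnum x t.+1)^-1 *: row_t - (q / qnum x t.+1) *: y).
rewrite mulmxBl -!scalemxAl row_eq big_ord_recr /= mulrC -scalerA.
have -> : \prod_(r < t) - (qnum x (s - r).+1 / v ^ wt N r / qnum x r.+1) *: delta_mx 0 0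
   = delta_mx 0 (inord t) - y *m weight_lower s by rewrite y_eq addrK.
rewrite -/q; move: (delta_mx 0 (inord t)) (delta_mx 0 (inord t.+1)) (y *m _) => d d' z.
by apply/rowP => u; rewrite !mxE; field.
Qed.

Lemma weight_eigen s : (s.+1 < N)%N -> exists y : 'rV[K]_s.+1,
  delta_mx 0 0 *m weight_braid s.+1 = eigenval s.+1 *: delta_mx 0 0 + y *m weight_lower s.
Proof.
move=> s_lt; have [y y_eq] := lower_quotient (ltnSn s.+1).
exists (x ^ (wt N 0 * wt N s.+1) *: y).
(* In [braidc] the condition j <= a with j = s + 1 leaves only a = s + 1. *)
have -> : delta_mx 0 0 *m weight_braid s.+1
          = x ^ (wt N 0 * wt N s.+1) *: (delta_mx 0 (inord s.+1) : 'rV[K]_s.+2).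
  rewrite -rowE; apply/rowP => u; rewrite !mxE /= subn0 -val_eqE /= inordK //.
  have u_lt := ltn_ord u; case: ltngtP => [u_s | u_s | u_s].
  - by rewrite braidc_eq0 // mulr0.
  - by lia.
  rewrite u_s subnn mulr1.
  have := @braidcE K x N s.+1 0 0; rewrite !addn0 => ->; [|lia|lia].
  by rewrite !big_ord0 !mulr1 divr1.
rewrite y_eq scalerDr scalemxAl scalerA; congr (_ *: _ + _).
rewrite /eigenval expfzDr // mulrCA; congr (_ * _).
rewrite -prod_invz_wt.
under eq_bigr => r _ do rewrite -mulN1r.
rewrite 3!big_split /= prodr_const card_ord; congr (_ * _).
rewrite mulrAC -[RHS]mul1r; congr (_ * _); rewrite prodfV.
(* The numerators [s+1-r] are the denominators [r+1] in reverse order, so the quantum integers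
   cancel. *)
rewrite (reindex_inj rev_ord_inj) /=.
under eq_bigr => r _ do rewrite subSS subKn ?leq_ord //.
by rewrite divff //; apply/prodf_neq0 => r _; apply: qnum_neq0.
Qed.

Lemma weight_trace s m : (s < N)%N ->
  \tr (weight_braid s ^+ m) = \sum_(i < s.+1) eigenval i ^+ m.
Proof.
elim: s => [|s IH] s_lt.
  have -> : weight_braid 0 = (eigenval 0)%:M.
    apply/matrixP => i a; rewrite !ord1 !mxE /= /eigenval.
    have := @braidcE K x N 0 0 0; rewrite !addn0 => ->; [|lia|lia].
    by rewrite !big_ord0 !mulr1 divr1 mul0r mulr0 addr0 mul1r.
  have -> : ((eigenval 0)%:M : 'M_1) ^+ m = (eigenval 0 ^+ m)%:M.
    by elim: m => [|m IH]; rewrite ?expr0 // !exprS IH scalar_mxM.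
  by rewrite mxtrace_scalar big_ord1.
rewrite big_ord_recr /= addrC -IH ?(ltnW s_lt) //.
have [y y_eq] := weight_eigen s_lt.
apply: mxtrace_exp_triangular (weight_lowerC s_lt) y_eq.
(* The change of basis is lower triangular with diagonal 1, [1], ..., [s+1], hence invertible. *)
have B_trig : is_trig_mx (col_mx (delta_mx 0 0 : 'rV[K]_s.+2) (weight_lower s) : 'M_s.+2).
  apply/is_trig_mxP => i j; rewrite mxE; case: splitP => k -> ij.
    by rewrite mxE -[j == 0]val_eqE /= gtn_eqF ?andbF // (leq_ltn_trans _ ij).
  rewrite mxE; have /gtn_eqF-> : (k.+1 < j)%N by [].
  by rewrite gtn_eqF ?(ltnW ij) // !mul0r addr0.
rewrite unitmxE (det_trig B_trig) unitfE; apply/prodf_neq0 => i _.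
rewrite mxE; case: splitP => k i_k.
  by rewrite mxE -[i == 0]val_eqE /= i_k !ord1 oner_neq0.
rewrite mxE i_k eqxx gtn_eqF // mul0r addr0 mul1r.
exact: (qnum_neq0 x_neq0 x_nonroot).
Qed.
End WeightSpaces.

(** * Decomposition of the quantum trace by weight spaces *)

Section QuantumTrace.
Variables (K : fieldType) (x : K).
Variable n : nat.
Let N := n.+1.

Definition braidm : 'M[K]_(N * N) :=
  \matrix_(r < N * N, s < N * N) braidc x N (r %/ N) (r %% N) (s %/ N) (s %% N).

Definition level (r : nat) : nat := (r %/ N + r %% N)%N.

Fact weight_index_subproof s (s_lt : (s < N)%N) (a : 'I_s.+1) : (a * N + (s - a) < N * N)%N.
Proof.
have a_le : (a <= s)%N by rewrite -ltnS.
have : (a.+1 * N <= N * N)%N by rewrite leq_mul2r (leq_trans _ s_lt) ?orbT.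
by apply: leq_trans; rewrite mulSn addnC ltn_add2r (leq_ltn_trans (leq_subr _ _)).
Qed.

Definition weight_index s (s_lt : (s < N)%N) (a : 'I_s.+1) : 'I_(N * N) :=
  Ordinal (weight_index_subproof s_lt a).

Lemma divn_weight_index s (s_lt : (s < N)%N) a : (weight_index s_lt a %/ N = a)%N.
Proof.
by rewrite /= divnMDl // divn_small ?addn0 // (leq_ltn_trans (leq_subr _ _)).
Qed.

Lemma modn_weight_index s (s_lt : (s < N)%N) a : (weight_index s_lt a %% N = s - a)%N.
Proof. by rewrite /= modnMDl modn_small // (leq_ltn_trans (leq_subr _ _)). Qed.

Lemma level_weight_index s (s_lt : (s < N)%N) a : level (weight_index s_lt a) = s.
Proof. by rewrite /level divn_weight_index modn_weight_index subnKC // -ltnS. Qed.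

Lemma sum_level s (s_lt : (s < N)%N) (f : 'I_(N * N) -> K) :
  \sum_(r < N * N | level r == s) f r = \sum_(a < s.+1) f (weight_index s_lt a).
Proof.
rewrite (reindex_onto (weight_index s_lt) (fun r => inord (r %/ N))).
  apply: eq_bigl => a; rewrite level_weight_index eqxx divn_weight_index.
  by apply/eqP/val_inj; rewrite /= inordK.
move=> r /eqP r_s; apply/val_inj; rewrite /= inordK -r_s ?ltnS ?leq_addr //.
by rewrite addKn -divn_eq.
Qed.

Lemma braidm_level (r t : 'I_(N * N)) : level r != level t -> braidm r t = 0.
Proof. by rewrite mxE /braidc /level => /negPf->. Qed.

Lemma braidm_weight s (s_lt : (s < N)%N) a b :
  braidm (weight_index s_lt a) (weight_index s_lt b) = weight_braid x N s a b.
Proof. by rewrite !mxE !divn_weight_index !modn_weight_index. Qed.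

Lemma braidm_exp_weight s (s_lt : (s < N)%N) m a b :
  (braidm ^+ m) (weight_index s_lt a) (weight_index s_lt b) = (weight_braid x N s ^+ m) a b.
Proof.
elim: m a => [|m IH] a.
  rewrite !expr0 !mxE; congr ((nat_of_bool _)%:R); apply/eqP/eqP => [|-> //].
  by move/(congr1 (fun r : 'I_(N * N) => r %/ N)%N); rewrite !divn_weight_index => /val_inj.
rewrite !exprS !mxE (bigID (fun r : 'I_(N * N) => level r == s)) /= sum_level [X in _ + X]big1.
  by rewrite addr0; apply: eq_bigr => c _; rewrite braidm_weight IH.
by move=> r r_s; rewrite braidm_level ?mul0r // level_weight_index eq_sym.
Qed.

Lemma sum_level_exp s (s_lt : (s < N)%N) m :
  \sum_(r < N * N | level r == s) (braidm ^+ m) r r = \tr (weight_braid x N s ^+ m).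
Proof. by rewrite sum_level; apply: eq_bigr => a _; rewrite braidm_exp_weight. Qed.

(** The reflection negates both weights, which leaves their product unchanged, and interchanges the
    two products of quantum integers. *)
Lemma braidc_sym i j a b : (i < N)%N -> (j < N)%N -> (a < N)%N -> (b < N)%N ->
  braidc x N (n - j) (n - i) (n - b) (n - a) = braidc x N i j a b.
Proof.
move=> i_lt j_lt a_lt b_lt; rewrite /braidc a_lt b_lt !ltnS !leq_subr !andbT.
have -> : ((n - j + (n - i) == n - b + (n - a)) && (n - i <= n - b))%N
          = ((i + j == a + b) && (j <= a))%N by rewrite /N in i_lt j_lt a_lt b_lt; lia.
case: ifP => // /andP[/eqP ij_ab j_a].
have wt_opp k : (k < N)%N -> wt N (n - k) = - wt N k.
  by rewrite /wt /N; lia.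
rewrite !wt_opp // mulrNN [wt N a * _]mulrC.
have -> : (n - b - (n - i) = a - j)%N by rewrite /N in i_lt j_lt a_lt b_lt; lia.
rewrite -!mulrA; do 4!congr (_ * _); rewrite mulrC.
congr (_ * _); apply: eq_bigr => t _; congr qnum; rewrite /N in i_lt j_lt a_lt b_lt *; lia.
Qed.

Fact swap_index_subproof (r : 'I_(N * N)) : ((n - r %% N) * N + (n - r %/ N) < N * N)%N.
Proof.
have : ((n - r %% N).+1 * N <= N * N)%N by rewrite leq_mul2r orbC ltnS leq_subr.
by apply: leq_trans; rewrite mulSn addnC ltn_add2r ltnS leq_subr.
Qed.

Definition swap_index (r : 'I_(N * N)) : 'I_(N * N) := Ordinal (swap_index_subproof r).

Lemma divn_swap_index r : (swap_index r %/ N = n - r %% N)%N.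
Proof. by rewrite /= divnMDl // divn_small ?addn0 // ltnS leq_subr. Qed.

Lemma modn_swap_index r : (swap_index r %% N = n - r %/ N)%N.
Proof. by rewrite /= modnMDl modn_small // ltnS leq_subr. Qed.

Lemma divn_index_le (r : 'I_(N * N)) : (r %/ N <= n)%N.
Proof. by rewrite -ltnS ltn_divLR. Qed.

Lemma modn_index_le (r : 'I_(N * N)) : (r %% N <= n)%N.
Proof. by rewrite -ltnS ltn_mod. Qed.

Lemma swap_indexK : involutive swap_index.
Proof.
move=> r; apply/val_inj; rewrite {1}/swap_index [LHS]/= divn_swap_index modn_swap_index.
by rewrite !subKn ?divn_index_le ?modn_index_le // -divn_eq.
Qed.

Lemma level_swap_index r : level (swap_index r) = (n.*2 - level r)%N.
Proof.
rewrite /level divn_swap_index modn_swap_index.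
by have := divn_index_le r; have := modn_index_le r; lia.
Qed.

Lemma braidm_exp_swap m r t : (braidm ^+ m) (swap_index r) (swap_index t) = (braidm ^+ m) r t.
Proof.
elim: m r => [|m IH] r.
  by rewrite !expr0 !mxE (inj_eq (inv_inj swap_indexK)).
rewrite !exprS !mxE (reindex_inj (inv_inj swap_indexK)) /=; apply: eq_bigr => u _.
rewrite IH !mxE !divn_swap_index !modn_swap_index braidc_sym //;
by rewrite ltnS ?divn_index_le ?modn_index_le.
Qed.

(** Joint pivotal weight of level s and its mirror 2n - s; the boolean factor keeps the middle level
    s = n from being counted twice. *)
Definition level_weight s : K := x ^ (4 * (n%:Z - s%:Z)) + (s < n)%:R * x ^ (- (4 * (n%:Z - s%:Z))).

Lemma qtrace_level m :
  \sum_(r < N * N) x ^ (2 * (wt N (r %/ N) + wt N (r %% N))) * (braidm ^+ m) r r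
  = \sum_(s < N) level_weight s * \tr (weight_braid x N s ^+ m).
Proof.
have wt_level r : 2 * (wt N (r %/ N) + wt N (r %% N)) = 4 * (n%:Z - (level r)%:Z).
  by rewrite /wt /level; lia.
under eq_bigr => r _ do rewrite wt_level.
rewrite (bigID (fun r : 'I__ => level r <= n)%N) /=.
(* The levels above n are folded onto those below n: the swap preserves diagonal entries and inverts
   the pivotal weight. *)
rewrite [X in _ + X](reindex_inj (inv_inj swap_indexK)) /=.
have level_le (r : 'I_(N * N)) : (level r <= n.*2)%N.
  by have := divn_index_le r; have := modn_index_le r; rewrite /level; lia.
rewrite [X in _ + X](_ : _ = \sum_(r < N * N | (level r <= n)%N)
    (level r < n)%:R * x ^ (- (4 * (n%:Z - (level r)%:Z))) * (braidm ^+ m) r r); last first.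
  rewrite big_mkcond [RHS]big_mkcond /=; apply: eq_bigr => r _.
  rewrite [level _]level_swap_index braidm_exp_swap.
  have := level_le r; case: ltngtP => [lt_n|gt_n|->] lev_le.
  - rewrite mul1r ifT; last by lia.
    by congr (x ^ _ * _); lia.
  - by rewrite ifF //; lia.
  - by rewrite !mul0r ifF //; lia.
rewrite -big_split /=.
under eq_bigr => r _ do rewrite -mulrDl -/(level_weight _).
rewrite (partition_big (fun r : 'I_(N * N) => inord (level r) : 'I_N) xpredT) //=.
apply: eq_bigr => s _; rewrite -(sum_level_exp (ltn_ord s)) big_distrr /=.
apply: eq_big => [r|r /andP[r_le /eqP <-]]; last by rewrite inordK.
case: leqP => [r_le|r_gt]; first by rewrite -val_eqE /= inordK.
by apply/esym/negbTE; apply/eqP => r_s; have := ltn_ord s; rewrite -r_s; lia.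
Qed.
End QuantumTrace.

(** * Theta exponents and summation by parts *)

(** [theta_exp1] and [theta_exp2] are the exponents of f(-q^(2k), -q) at the indices d and -(d+1),
    in the shape used by [theta_term]. *)
Definition theta_exp1 (k d : nat) : nat := (2 * k * (d * d.+1)./2 + 1 * (d * d.-1)./2)%N.
Definition theta_exp2 (k d : nat) : nat := (2 * k * (d * d.+1)./2 + 1 * (d.+1 * d.+2)./2)%N.

Lemma half_mulnS d : ((d * d.+1)./2 * 2 = d * d.+1)%N.
Proof. by have := odd_double_half (d * d.+1); rewrite oddM /= andbN add0n muln2. Qed.

Lemma theta_exp1_double k d : (theta_exp1 k d * 2 + 2 * d = (2 * k + 1) * (d * d.+1))%N.
Proof.
have := half_mulnS d; rewrite /theta_exp1; case: d => [|d]; first by rewrite !mul0n !muln0.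
by have := half_mulnS d; rewrite /= [(d.+1 * d)%N]mulnC; nia.
Qed.

Lemma theta_exp2_double k d : (theta_exp2 k d * 2 = (2 * k + 1) * (d * d.+1) + 2 * d.+1)%N.
Proof. by have := half_mulnS d; have := half_mulnS d.+1; rewrite /theta_exp2; nia. Qed.

Section GenericJones.
Variables (K : fieldType) (x : K).
Hypotheses (x_neq0 : x != 0) (x_nonroot : forall n, (0 < n)%N -> x ^+ n != 1).

Let v := x ^+ 2.
Let v_neq0 : v != 0. Proof. exact: expf_neq0. Qed.
Let vB d : K := v ^+ d - v ^- d.

Lemma level_weightS n s : level_weight x n.+1 s.+1 = level_weight x n s.
Proof. by rewrite /level_weight ltnS !intS opprD addrACA subrr add0r. Qed.

Lemma level_weight_recl n :
  (v - v^-1) * level_weight x n.+1 0 = vB (2 * n.+1).+1 - vB (2 * n).+1.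
Proof.
rewrite /level_weight mul1r subr0 /vB.
have -> : x ^ (4 * n.+1%:Z) = v ^+ (2 * n.+1) by rewrite -exprM mulnA.
have -> : x ^ (- (4 * n.+1%:Z)) = v ^- (2 * n.+1) by rewrite -invr_expz -exprM mulnA.
rewrite mulnS exprS !add2n !(exprS v).
have w0 : v ^+ (2 * n) != 0 by rewrite expf_neq0.
set w := v ^+ _ in w0 *.
by field; rewrite w0 v_neq0.
Qed.

(** The sum runs over q^j for -n <= j <= n and is geometric with ratio q = v^2. *)
Lemma sum_level_weight n : (v - v^-1) * \sum_(s < n.+1) level_weight x n s = vB (2 * n).+1.
Proof.
elim: n => [|n IH].
  by rewrite big_ord1 /level_weight subrr mulr0 ltnn mul0r addr0 mulr1.
rewrite big_ord_recl mulrDr level_weight_recl.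
under eq_bigr => s _ do rewrite lift0 level_weightS.
by rewrite IH subrK.
Qed.

(** After exchanging the sums, L i is multiplied by the weights of the levels s >= i, which add up
    as in [sum_level_weight] for n - i. *)
Lemma sum_level_weight_partial n (L : nat -> K) :
  (v - v^-1) * \sum_(s < n.+1) level_weight x n s * (\sum_(i < s.+1) L i)
  = \sum_(i < n.+1) L i * vB (2 * (n - i)).+1.
Proof.
elim: n L => [|n IH] L.
  by rewrite !big_ord1 mulrA mulrC -sum_level_weight big_ord1.
rewrite [in RHS]big_ord_recl subn0 -(IH (fun i => L i.+1)) -sum_level_weight.
rewrite mulrCA -mulrDr; congr (_ * _); rewrite mulr_sumr !(big_ord_recl n.+1).
rewrite big_ord1 mulrC -addrA; congr (_ + _); rewrite -big_split /=.
apply: eq_bigr => s _; rewrite /bump add1n level_weightS big_ord_recl mulrDr mulrC.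
by congr (_ + _ * _); apply: eq_bigr => i _; rewrite lift0.
Qed.

(** Counting d = n - i from the top separates the exponent into the quadratic part of the theta
    exponents and the framing constant N^2 - 1. *)
Lemma eigenval_rev n d : (d <= n)%N ->
  eigenval x n.+1 (n - d)
  = (-1) ^+ n * (-1) ^+ d * x ^ (2 * (d%:Z * d.+1%:Z) - ((n.+1 ^ 2)%:Z - 1)).
Proof.
move=> d_le; rewrite /eigenval -exprD -signr_odd oddB // -oddD signr_odd.
congr (_ * x ^ _); rewrite /wt -subzn // expnS expn1 PoszM !intS; ring.
Qed.

Definition generic_jones n (m : nat) : K :=
  x ^ (((n.+1 ^ 2)%:Z - 1) * (- m%:Z))
  * (\sum_(r < n.+1 * n.+1) x ^ (2 * (wt n.+1 (r %/ n.+1) + wt n.+1 (r %% n.+1)))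
       * (braidm x n ^+ m) r r)
  / qnum x n.+1.

Let q := x ^+ 4.

Lemma qtrace_theta n k :
  (v - v^-1) * (\sum_(r < n.+1 * n.+1) x ^ (2 * (wt n.+1 (r %/ n.+1) + wt n.+1 (r %% n.+1)))
       * (braidm x n ^+ (2 * k + 1)) r r)
  = - (x ^ (((n.+1 ^ 2)%:Z - 1) * (- (2 * k + 1)%:Z)) * (-1) ^+ n * x ^- 2)
    * \sum_(d < n.+1) (-1) ^+ d * (q ^+ theta_exp1 k d - q ^+ theta_exp2 k d).
Proof.
set m := (2 * k + 1)%N; rewrite qtrace_level.
under eq_bigr => s _ do rewrite weight_trace //.
rewrite (sum_level_weight_partial n (fun i => eigenval x n.+1 i ^+ m)).
rewrite (reindex_inj rev_ord_inj) mulr_sumr; apply: eq_bigr => d _ /=.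
have d_le : (d <= n)%N by rewrite leq_ord.
rewrite subSS subKn // eigenval_rev //.
set M := (n.+1 ^ 2)%:Z - 1; rewrite exprMn.
have -> : ((-1) ^+ n * (-1) ^+ d : K) ^+ m = (-1) ^+ n * (-1) ^+ d.
  by rewrite -exprD exprAC; congr (_ ^+ _); rewrite -signr_odd /m oddD oddM.
rewrite [_ ^+ m]exprnP exprz_exp.
(* With w = q^d the theta monomials are Z / w and Z w q, and Z times [vB (2 * d).+1] is -x^(-2)
   times their difference. *)
pose Z := x ^+ (2 * (d * d.+1) * m).
have -> : x ^ ((2 * (d%:Z * d.+1%:Z) - M) * m%:Z) = Z * x ^ (M * - m%:Z).
  by rewrite mulrBl -mulrN expfzDr // /Z exprnP !PoszM.
pose w := x ^+ (4 * d); have w0 : w != 0 by rewrite expf_neq0.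
have -> : q ^+ theta_exp1 k d = Z / w.
  apply: (mulIf w0); rewrite divfK // -exprM -exprD; congr (_ ^+ _).
  by have := theta_exp1_double k d; rewrite -/m; lia.
have -> : q ^+ theta_exp2 k d = Z * w * x ^+ 4.
  rewrite -exprM -!exprD; congr (_ ^+ _).
  by have := theta_exp2_double k d; rewrite -/m; lia.
have -> : vB (2 * d).+1 = x ^+ 2 * w - (x ^+ 2 * w)^-1.
  by rewrite /vB exprS -exprM mulnA.
by field; rewrite w0 x_neq0.
Qed.

(** Dividing by [N] (v - v^-1) = -v^(-N) (1 - q^N) produces the factor 1 - q^N. The monomial undoes
    two framing factors, one from the normalization and one from the quantum trace. *)
Lemma generic_jones_theta n k :
  (-1) ^+ n * x ^ (2 * (((n.+1 ^ 2)%:Z - 1) * (2 * k + 1)%:Z) + 2 - 2 * n.+1%:Z)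
    * generic_jones n (2 * k + 1) * (1 - q ^+ n.+1)
  = \sum_(d < n.+1) (-1) ^+ d * (q ^+ theta_exp1 k d - q ^+ theta_exp2 k d).
Proof.
set S := \sum_(d < _) _; set M := (n.+1 ^ 2)%:Z - 1; set m := (2 * k + 1)%N.
have S_eq := qtrace_theta n k; rewrite -/S -/M -/m in S_eq.
rewrite /generic_jones -/M -/m; set tr := \sum_(r < _) _ in S_eq *.
set y := x ^ (M * - m%:Z) in S_eq *; have y0 : y != 0 by rewrite expfz_neq0.
have -> : x ^ (2 * (M * m%:Z) + 2 - 2 * n.+1%:Z) = x ^+ 2 / (y ^+ 2 * v ^+ n.+1).
  have -> : (y ^+ 2 * v ^+ n.+1)^-1 = x ^ (M * m%:Z * 2) * x ^ (- (2 * n.+1%:Z)).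
    rewrite invfM -exprM -[in RHS]invr_expz; congr (_ * _).
    by rewrite -exprVn /y mulrN invr_expz opprK exprnP exprz_exp.
  by rewrite [x ^+ 2]exprnP -!expfzDr //; congr (x ^ _); ring.
have W0 : v ^+ n.+1 != 0 by rewrite expf_neq0.
have D0 := subV_neq0 x_neq0 x_nonroot; have N0 := expn_subV_neq0 x_neq0 x_nonroot (ltn0Sn n).
have -> : 1 - q ^+ n.+1 = - (v ^+ n.+1 - v ^- n.+1) * v ^+ n.+1.
  have -> : q ^+ n.+1 = (v ^+ n.+1) ^+ 2 by rewrite -!exprM; congr (_ ^+ _); lia.
  by move: (v ^+ _) W0 => W W0; field.
rewrite /qnum -/v invf_div.
have -> : tr = - (y * (-1) ^+ n * x ^- 2) * S / (v - v^-1) by rewrite -S_eq mulrC mulKf.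
set D := v - v^-1 in D0 *; set W := v ^+ _ in N0 W0 *; set V := W - W^-1 in N0 *.
rewrite -signr_odd; case: (odd n); rewrite ?expr0 ?expr1 -[x ^+ 2]/v;
  field; by rewrite ?v_neq0 ?y0 ?W0 ?N0 ?D0.
Qed.
End GenericJones.

(** * Vanishing of the theta sum at N-th roots of unity *)

Lemma sum_periodic_shift (V : zmodType) (P : nat) (t : nat -> V) h :
  (forall i, t (i + P)%N = t i) -> \sum_(i < P) t (i + h)%N = \sum_(i < P) t i.
Proof.
move=> tP; elim: h => [|h IH]; first by apply: eq_bigr => i _; rewrite addn0.
rewrite -IH; case: P tP {IH} => [|P] tP; first by rewrite !big_ord0.
rewrite big_ord_recr [RHS]big_ord_recl /= addrC add0n; congr (_ + _).
  by rewrite addnS -addSn addnC tP.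
by apply: eq_bigr => i _; rewrite /bump addnS -addSn.
Qed.

Section RootOfUnitySum.
Variables (K : numFieldType) (N k d : nat) (w : K).
Hypotheses (N_gt0 : (0 < N)%N) (w_prim : d.-primitive_root w) (d_N : (d %| N)%N).

Let m := (2 * k + 1)%N.
Let t (i : nat) : K := (-1) ^+ i * w ^+ theta_exp1 k i.

Let wN : w ^+ N = 1.
Proof. by case/dvdnP: d_N => l ->; rewrite mulnC exprM (prim_expr_order w_prim) expr1n. Qed.

Let expr_eq a b A B : (a + A * N = b + B * N)%N -> w ^+ a = w ^+ b.
Proof.
move=> ab; transitivity (w ^+ (a + A * N)).
  by rewrite exprD mulnC exprM wN expr1n mulr1.
by rewrite ab exprD mulnC exprM wN expr1n mulr1.
Qed.

Lemma theta_term_periodic i : t (i + 2 * N)%N = t i.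
Proof.
rewrite /t exprD exprM sqrrN !expr1n mulr1; congr (_ * _).
(* The exponent grows by N (m (2i + 1) + 2mN) - 2N. *)
apply: (@expr_eq _ _ 2 (m * (2 * i + 1) + 2 * m * N)).
have := theta_exp1_double k (i + 2 * N); have := theta_exp1_double k i; rewrite -/m.
nia.
Qed.

(** The second exponent at i is the first one at -(i+1), which is 2N - (i+1) modulo the period; both
    halves thus form one sum over a full period. *)
Lemma theta_term_reflect i : (i < N)%N ->
  (-1) ^+ i * w ^+ theta_exp2 k i = - t (2 * N - i.+1)%N.
Proof.
move=> i_lt; rewrite /t -mulNr; congr (_ * _).
  rewrite -signr_odd -[in RHS]signr_odd oddB; last by lia.
  by rewrite mul2n odd_double /=; case: (odd i); rewrite /= ?expr0 ?expr1 ?opprK.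
have [c c_def] : exists c, c = (2 * N - i.+1)%N by exists (2 * N - i.+1)%N.
rewrite -c_def; have ci : (c + i.+1 = 2 * N)%N by lia.
apply: (@expr_eq _ _ (2 * m * N) (m * (2 * i + 1) + 2)).
have := theta_exp1_double k c; have := theta_exp2_double k i; rewrite -/m.
have : (c * c.+1 + 2 * N * (2 * i + 1) = 4 * N * N + i * i.+1)%N by nia.
nia.
Qed.

Lemma theta_sum_double :
  \sum_(i < N) (-1) ^+ i * (w ^+ theta_exp1 k i - w ^+ theta_exp2 k i)
  = \sum_(i < 2 * N) t i.
Proof.
rewrite mul2n -addnn big_split_ord /= [X in _ + X](reindex_inj rev_ord_inj) /= -big_split.
apply: eq_bigr => i _; rewrite mulrBr theta_term_reflect // opprK; congr (_ + t _).
by have := ltn_ord i; lia.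
Qed.

Lemma theta_sum_coprime : coprime m d -> \sum_(i < 2 * N) t i = 0.
Proof.
move=> m_d; have m_gt0 : (0 < m)%N by rewrite /m addn1.
case: (egcdnP d m_gt0) => e0 l0; rewrite (eqP m_d) => el0 _.
have d_gt0 := prim_order_gt0 w_prim.
(* Adding these multiples keeps e m = l d + 1 and gives e >= N, so the reflected indices are natural
   numbers. *)
pose e := (e0 + d * N)%N; pose l := (l0 + m * N)%N.
have el : (e * m = l * d + 1)%N by rewrite /e /l; nia.
have e_ge : (N <= e)%N by rewrite /e; nia.
have t_reflect i : (i < 2 * N)%N -> t i = - t (2 * e - i.+1)%N.
  move=> i_lt; rewrite /t -mulNr; congr (_ * _).
    rewrite -signr_odd -[in RHS]signr_odd oddB; last by lia.
    by rewrite mul2n odd_double /=; case: (odd i); rewrite /= ?expr0 ?expr1 ?opprK.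
  have [j j_def] : exists j, j = (2 * e - i.+1)%N by exists (2 * e - i.+1)%N.
  rewrite -j_def; have ij : (i + j + 1 = 2 * e)%N by lia.
  (* The difference of exponents is (i - j)(m (i + j + 1) - 2) / 2 = (i - j)(e m - 1) = (i - j) l
     d. *)
  have : (theta_exp1 k i + j * l * d = theta_exp1 k j + i * l * d)%N.
    have el_mul a : (a * l * d + a = a * e * m)%N by rewrite -!mulnA el mulnDr muln1.
    have ij_mul a : (2 * (a * e * m) = m * (a * (i + j + 1)))%N by rewrite ij; lia.
    have := theta_exp1_double k i; have := theta_exp1_double k j; rewrite -/m.
    have := el_mul i; have := el_mul j; have := ij_mul i; have := ij_mul j.
    clear; lia.
  by move/(congr1 (fun a => w ^+ a)); rewrite !exprD ![(_ * d)%N]mulnC !exprM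
    (prim_expr_order w_prim) !expr1n !mulr1.
have S_opp : \sum_(i < 2 * N) t i = - \sum_(i < 2 * N) t i.
  rewrite -[in RHS](sum_periodic_shift (2 * e - 2 * N) theta_term_periodic).
  rewrite [in RHS](reindex_inj rev_ord_inj) -sumrN; apply: eq_bigr => i _ /=.
  by rewrite t_reflect //; congr (- t _); have := ltn_ord i; lia.
by apply/eqP; rewrite -[_ == 0](mulrn_eq0 _ 2) /= mulr2n {1}S_opp addNr.
Qed.

Lemma theta_sum_not_coprime : ~~ coprime m d -> \sum_(i < 2 * N) t i = 0.
Proof.
set g := gcdn m d; have d_gt0 := prim_order_gt0 w_prim.
rewrite /coprime -/g => g_neq1.
have [h dE] : exists h, d = (h * g)%N by apply/dvdnP/dvdn_gcdr.
have [l mE] : exists l, m = (l * g)%N by apply/dvdnP/dvdn_gcdl.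
(* Since m h = l d, a shift by 2h changes the exponent by -2h modulo d; being even, it keeps the
   sign. *)
have t_shift i : t (i + 2 * h)%N * w ^+ (2 * h) = t i.
  rewrite /t exprD exprM sqrrN !expr1n mulr1 -mulrA -exprD; congr (_ * _).
  have -> : (theta_exp1 k (i + 2 * h) + 2 * h = theta_exp1 k i + d * (l * (2 * i + 1 + 2 * h)))%N.
    have := theta_exp1_double k i; have := theta_exp1_double k (i + 2 * h); rewrite -/m dE mE.
    nia.
  by rewrite exprD exprM (prim_expr_order w_prim) expr1n mulr1.
(* Otherwise d = h g divides 2h, so g divides 2, but g is odd and not 1. *)
have wh_neq1 : w ^+ (2 * h) != 1.
  rewrite -(prim_order_dvd w_prim) dE mulnC dvdn_pmul2r; last by lia.
  apply/negP => g_dvd2; have g_le2 := dvdn_leq (isT : (0 < 2)%N) g_dvd2.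
  have g_odd : odd g.
    by apply: dvdn_odd (dvdn_gcdl m d) _; rewrite /m oddD oddM.
  by case: (g) g_le2 g_odd g_neq1 => [|[|[|]]].
have S_eq : (\sum_(i < 2 * N) t i) * w ^+ (2 * h) = \sum_(i < 2 * N) t i.
  rewrite -{1}(sum_periodic_shift (2 * h) theta_term_periodic) mulr_suml.
  by apply: eq_bigr => i _; rewrite t_shift.
have /eqP : (\sum_(i < 2 * N) t i) * (w ^+ (2 * h) - 1) = 0.
  by rewrite mulrBr mulr1 S_eq subrr.
by rewrite mulf_eq0 subr_eq0 (negPf wh_neq1) orbF => /eqP.
Qed.

Lemma theta_sum_root_of_unity :
  \sum_(i < N) (-1) ^+ i * (w ^+ theta_exp1 k i - w ^+ theta_exp2 k i) = 0.
Proof.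
rewrite theta_sum_double.
by have [/theta_sum_coprime|/theta_sum_not_coprime] := boolP (coprime m d).
Qed.
End RootOfUnitySum.

(** * Divisibility by 1 - q^N and comparison with the theta coefficients *)

Definition theta_poly (k N : nat) : {poly rat} :=
  \sum_(i < N) (-1) ^+ i * ('X^(theta_exp1 k i) - 'X^(theta_exp2 k i)).

(** Divisibility may be tested over [algC], where X^N - 1 has N distinct roots, each of some exact
    order dividing N. *)
Lemma theta_poly_dvd k N : (0 < N)%N -> 'X^N - 1 %| theta_poly k N.
Proof.
move=> N_gt0; have [z z_prim] := C_prim_root_exists N_gt0.
rewrite -(dvdp_map (ratr : {rmorphism rat -> algC})) rmorphB rmorph1 /= map_polyXn.
rewrite -(factor_Xn_sub_1 z_prim).
set P := map_poly _ _.
have -> : \prod_(0 <= i < N) ('X - (z ^+ i)%:P)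
          = \prod_(y <- [seq z ^+ i | i <- index_iota 0 N]) ('X - y%:P).
  by rewrite big_map.
apply: uniq_roots_dvdp; last first.
  rewrite uniq_rootsE map_inj_in_uniq ?iota_uniq // => i j.
  rewrite !mem_index_iota /= => i_lt j_lt /eqP; rewrite (eq_prim_root_expr z_prim).
  by rewrite !modn_small // => /eqP.
apply/allP => _ /mapP[i _ ->].
have ziN : (z ^+ i) ^+ N = 1 by rewrite exprAC (prim_expr_order z_prim) expr1n.
have [d d_prim d_N] := prim_order_exists N_gt0 ziN.
apply/rootP; rewrite -(theta_sum_root_of_unity k N_gt0 d_prim d_N).
rewrite /P /theta_poly rmorph_sum horner_sum; apply: eq_bigr => j _ /=.
by rewrite rmorphM rmorphXn rmorphB rmorphN1 /= !map_polyXn !hornerE.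
Qed.

Lemma coef_theta_poly k N j : (0 < k)%N -> (j < N)%N ->
  (theta_poly k N)`_j = (theta_coef (-1) (-1) (2 * k) 1 j)%:~R.
Proof.
move=> k_gt0 j_lt.
have sign_mul A B i : odd (A + B) = odd i -> (-1) ^+ A * (-1) ^+ B = (-1) ^+ i :> int.
  by move=> AB; rewrite -exprD -signr_odd AB signr_odd.
(* The two exponents A + B are i^2 here and (i+1)^2 in [term2], which gives the opposite signs. *)
have term1 i : theta_term (-1) (-1) (2 * k) 1 (i * i.+1)./2 (i * i.-1)./2 j
    = (-1) ^+ i * (j == theta_exp1 k i)%:R.
  rewrite /theta_term -/(theta_exp1 k i) eq_sym; case: eqP => _; last by rewrite mulr0.
  rewrite mulr1; apply: sign_mul.
  rewrite (_ : _ + _ = i * i)%N ?oddM ?andbb //.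
  case: i => [|i] //=; have := half_mulnS i.+1; have := half_mulnS i.
  by rewrite [(i * i.+1)%N]mulnC; nia.
have term2 i : theta_term (-1) (-1) (2 * k) 1 (i * i.+1)./2 (i.+1 * i.+2)./2 j
    = - ((-1) ^+ i * (j == theta_exp2 k i)%:R).
  rewrite /theta_term -/(theta_exp2 k i) eq_sym; case: eqP => _; last by rewrite mulr0 oppr0.
  rewrite mulr1 -[RHS]mulN1r -[RHS]exprS; apply: sign_mul.
  rewrite (_ : _ + _ = i.+1 * i.+1)%N ?oddM ?andbb //.
  by have := half_mulnS i.+1; have := half_mulnS i; nia.
rewrite /theta_coef -big_split /=.
under [in RHS]eq_bigr => i _ do rewrite term1 term2 -mulrBr.
rewrite rmorph_sum /= (big_ord_widen N (fun i => ((-1) ^+ i * ((j == theta_exp1 k i)%:R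
  - (j == theta_exp2 k i)%:R))%:~R)) // big_mkcond /theta_poly coef_sum.
apply: eq_bigr => i _.
have -> : (-1) ^+ i = ((-1) ^+ i)%:P :> {poly rat} by rewrite rmorphXn rmorphN1.
rewrite coefCM coefB !coefXn.
case: leqP => [j_lt_i|_]; last first.
  rewrite -signr_odd -[in RHS]signr_odd.
  by case: (odd i); case: (j == _); case: (j == _); apply/eqP.
(* As k >= 1, both exponents are at least i (i + 1), so the terms with i > j do not reach degree
   j. *)
have le_half : (i * i.+1 <= 2 * k * (i * i.+1)./2)%N.
  by have := half_mulnS i; nia.
by rewrite /theta_exp1 /theta_exp2 !ltn_eqF ?subrr ?mulr0 //; nia.
Qed.

(** The quotient of [theta_poly] by 1 - X^N has the same coefficients below degree N, and evaluating
    it gives the normalized invariant. *)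
Lemma generic_jones_tail (K : fieldType) (x : K) (f : {rmorphism rat -> K}) n k :
  x != 0 -> (forall i, (0 < i)%N -> x ^+ i != 1) -> (0 < k)%N ->
  exists p : {poly rat},
    (-1) ^+ n * x ^ (2 * (((n.+1 ^ 2)%:Z - 1) * (2 * k + 1)%:Z) + 2 - 2 * n.+1%:Z)
      * generic_jones x n (2 * k + 1) = (map_poly f p).[x ^+ 4]
    /\ forall j : nat, (j < n.+1)%N -> p`_j = (theta_coef (-1) (-1) (2 * k) 1 j)%:~R.
Proof.
move=> x_neq0 x_nonroot k_gt0.
have /dvdpP[p0 p0E] := theta_poly_dvd k (ltn0Sn n).
have thetaE : theta_poly k n.+1 = - p0 * (1 - 'X^(n.+1)) by rewrite p0E mulNr -mulrN opprB.
exists (- p0); split; last first.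
  move=> j j_lt; rewrite -(coef_theta_poly k_gt0 j_lt) thetaE mulrBr mulr1 coefB coefMXn j_lt.
  by rewrite subr0.
have q_neq1 : 1 - (x ^+ 4) ^+ n.+1 != 0.
  by rewrite subr_eq0 eq_sym -exprM x_nonroot.
apply: (mulIf q_neq1); rewrite generic_jones_theta //.
transitivity (map_poly f (theta_poly k n.+1)).[x ^+ 4].
  rewrite /theta_poly rmorph_sum horner_sum; apply: eq_bigr => j _ /=.
  by rewrite rmorphM rmorphXn rmorphB rmorphN1 /= !map_polyXn !hornerE.
by rewrite thetaE rmorphM rmorphB rmorph1 /= map_polyXn hornerM !hornerE.
Qed.

(** * Specialization to x = q^(1/4) *)

Lemma qx_neq0 : qx != 0.
Proof. by rewrite /qx /frac_of tofrac_eq0 polyX_eq0. Qed.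

Lemma qx_nonroot n : (0 < n)%N -> qx ^+ n != 1.
Proof.
move=> n_gt0; rewrite /qx /frac_of -tofracXn -tofrac1 tofrac_eq.
apply/eqP => /(congr1 (fun p : {poly rat} => size p)).
rewrite size_polyXn size_poly1 => -[n0]; by rewrite n0 in n_gt0.
Qed.

(** The successor makes the exponent reduce to [Negz m], where [braid_rep] is an iterated product of
    the braiding itself. *)
Lemma cjones_2braidE n m :
  cjones_2braid n.+1 (- (m.+1)%:Z) = generic_jones qx n m.+1.
Proof.
rewrite /cjones_2braid /generic_jones /qtrace.
have -> : braid_rep n.+1 (- (m.+1)%:Z) = (braidm qx n ^+ m.+1).
  by rewrite -iter_mulr_1.
by [].
Qed.

(* The negative (2,2k+1)-torus knot is the closure of sigma_1^(-(2k+1));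
   its tail exists and equals f(-q^(2k), -q). *)
Theorem mainTheorem3 (k : nat) (hk : (1 <= k)%N) :
  forall N : nat, (1 <= N)%N ->
    approx_eq (cjones_2braid N (- (2 * k + 1)%:Z)) N
              (theta_coef (-1) (-1) (2 * k) 1).
Proof.
case=> // n _; rewrite {1}addn1 cjones_2braidE -addn1.
have [p [p_eq p_coef]] :=
  generic_jones_tail (@FracField.tofrac {poly rat} \o polyC) n qx_neq0 qx_nonroot hk.
by exists (odd n), (2 * (((n.+1 ^ 2)%:Z - 1) * (2 * k + 1)%:Z) + 2 - 2 * n.+1%:Z), p;
  rewrite signr_odd.
Qed.
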